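(* Let $\mathcal{H}$ be a nonempty finite class of hypotheses $h:X\to\{-1,+1\}$ and let $m\ge1$ be an integer. For any probability distribution $D$ on $X\times\{-1,+1\}$, any instance $x\in X$, any $\lambda>0$ and any $s\in\{-1,+1\}$, $$\Pr_{S\sim D^m}\left[\exists\,\eta\ge1:\ s\bigl(\ell_\eta(x)-\hat\ell_\eta(x)\bigr)\ge2\lambda+\frac{\eta}{8m}\right]\le\frac{8\ln|\mathcal{H}|}{\lambda}\,e^{-\lambda^2m/2}.$$
   Context: $X$ is a measurable space and all hypotheses are measurable. $S=((x_1,y_1),\dots,(x_m,y_m))$ is a sample of $m$ examples drawn independently from $D$. For $h\in\mathcal{H}$, the true error is $\varepsilon(h)=\Pr_{(x,y)\sim D}[h(x)\ne y]$ and the empirical error is $\hat\varepsilon(h)=\frac1m\sum_{i=1}^m \mathbf{1}[h(x_i)\ne y_i]$. For $\eta>0$ and $x\in X$, the true and empirical log ratios are $$\ell_\eta(x)=\frac1\eta\ln\frac{\sum_{h\in\mathcal{H}:h(x)=+1}e^{-\eta\varepsilon(h)}}{\sum_{h\in\mathcal{H}:h(x)=-1}e^{-\eta\varepsilon(h)}},\qquad \hat\ell_\eta(x)=\frac1\eta\ln\frac{\sum_{h\in\mathcal{H}:h(x)=+1}e^{-\eta\hat\varepsilon(h)}}{\sum_{h\in\mathcal{H}:h(x)=-1}e^{-\eta\hat\varepsilon(h)}}.$$ Convention: if all hypotheses agree on $x$, both log ratios equal $+\infty$ (if all predict $+1$) or both equal $-\infty$ (if all predict $-1$), and then the difference $\ell_\eta(x)-\hat\ell_\eta(x)$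 is read as $0$. *)

(* Defs.v *)
From HB Require Import structures.
From mathcomp Require Import all_boot all_order all_algebra finmap.
From mathcomp Require Import all_classical all_reals all_analysis.

Set Implicit Arguments.
Unset Strict Implicit.
Unset Printing Implicit Defensive.
Import Order.TTheory GRing.Theory Num.Theory.
Import numFieldNormedType.Exports.

Local Open Scope classical_set_scope.
Local Open Scope ring_scope.

Section power_probability.
Context d (T : measurableType d) (R : realType).

Definition cons_pair n (p : T * n.-tuple T) : n.+1.-tuple T := [tuple of p.1 :: p.2].

Lemma measurable_cons_pair n : measurable_fun [set: T * n.-tuple T] (@cons_pair n).
Proof. exact: measurable_cons. Qed.

HB.instance Definition _ n :=
  isMeasurableFun.Build _ _ _ _ (@cons_pair n) (@measurable_cons_pair n).

(* The n-fold product P^n on n-tuples: the point mass at the empty tuple for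
   n = 0, and the image of P \x P^n under (z, t) |-> z :: t for n.+1.
   power_probability_rect below is its characteristic property. *)
Fixpoint power_probability (P : probability T R) n : probability (n.-tuple T) R :=
  match n with
  | 0 => \d_([tuple])
  | n'.+1 => distribution (P \x power_probability P n')%E (@cons_pair n')
  end.

Lemma power_probability_rect (P : probability T R) n (A : 'I_n -> set T) :
  (forall i, measurable (A i)) ->
  power_probability P n [set t | forall i, A i (tnth t i)] =
  (\prod_(i < n) P (A i))%E.
Proof.
elim: n A => [|n IH] A mA.
  by rewrite big_ord0 /= diracE mem_set//= => -[].
rewrite big_ord_recl -(IH (fun i => A (lift ord0 i)))//.
pose B : set (n.-tuple T) := [set t | forall i, A (lift ord0 i) (tnth t i)].
have mB : measurable B.
  rewrite (_ : B = \big[setI/setT]_(i < n) ((@tnth _ T ^~ i) @^-1` A (lift ord0 i))).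
    apply: bigsetI_measurable => i _; rewrite -[X in measurable X]setTI.
    exact: measurable_tnth.
  apply/seteqP; split=> t; rewrite -bigcap_seq /=.
    by move=> Bt i _; exact: Bt.
  by move=> h i; apply: (h i); rewrite /= mem_index_enum.
rewrite -product_measure1E//= /distribution /pushforward /=; congr (_ _).
apply/seteqP; split=> [[z t] /= h|[z t] /= [h0 h] i].
  split; first exact: (h ord0).
  by move=> i; have := h (lift ord0 i); rewrite tnthS.
case: (unliftP ord0 i) => [j ->|->]; last by [].
by rewrite tnthS; exact: h.
Qed.

End power_probability.

Section log_ratio.
Context d (X : measurableType d) (R : realType).

(* Labels are booleans: true stands for +1 and false for -1. *)

Definition true_error (D : probability (X * bool)%type R) (h : X -> bool) : R :=
  fine (D [set z | h z.1 != z.2]).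

Definition empirical_error m (S : m.-tuple (X * bool)) (h : X -> bool) : R :=
  m%:R^-1 * \sum_(i < m) (h (tnth S i).1 != (tnth S i).2)%:R.

(* err is instantiated with the true or the empirical error. The first two
   cases are those where all hypotheses agree on x (disjoint when H is
   nonempty). *)
Definition log_ratio (H : {fset X -> bool}) (err : (X -> bool) -> R) (eta : R)
    (x : X) : \bar R :=
  if all (fun h => h x) H then +oo%E
  else if all (fun h => ~~ h x) H then -oo%E
  else (eta^-1 * ln ((\sum_(h <- H | h x) expR (- eta * err h)) /
                     (\sum_(h <- H | ~~ h x) expR (- eta * err h))))%:E.

(* a - b, except that the difference of two equal infinities is 0; in \bar R,
   +oo - +oo and -oo - -oo both evaluate to -oo. *)
Definition diff0 (a b : \bar R) : \bar R := if a == b then 0%E else (a - b)%E.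

End log_ratio.

(* Main.v *)
Require Import Defs.
From HB Require Import structures.
From mathcomp Require Import all_boot all_order all_algebra finmap.
From mathcomp Require Import all_classical all_reals all_analysis.
From mathcomp Require Import ring lra.
Import Order.TTheory GRing.Theory Num.Theory.
Import numFieldNormedType.Exports.

Local Open Scope classical_set_scope.
Local Open Scope ring_scope.

(** Write R_K(eta) = (1/eta) ln (sum over h in K of exp (- eta * err h)), so that
    a log ratio is R_K(eta) - R_L(eta), where K and L are the sets of hypotheses
    predicting +1 and -1 on x. If one of them is empty the difference of log
    ratios is 0 and the event is empty.

    For fixed eta, the empirical R_K concentrates around the true one.
    - It moves by at most 1/m when one example changes, since every empirical
      error does; McDiarmid's inequality [mcdiarmid] then controls its deviation
      from its own mean, with tail exp (- 2 * tau^2 * m).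
    - That mean lies between R_K and R_K + eta/(8m). The lower bound
      [log_partition_risk_le] is Jensen's inequality for the convex function
      log-sum-exp; the upper bound [expect_log_partition_le] is Jensen's
      inequality for ln, followed by Hoeffding's bound on the moment generating
      function of each empirical error.
    In a difference of log ratios only one of the two classes pays the bias
    eta/(8m), and one of the two must deviate by lambda: [deviation] is this
    one-sided, bias-corrected quantity.

    For all eta >= 1 at once, use u = 1/eta, which ranges over ]0, 1]. As a
    function of u, R_K is nondecreasing and Lipschitz with constant ln #|K|: its
    derivative is the entropy of the Gibbs distribution. So a deviation by lambda
    at some eta forces a deviation by lambda/2 after rounding u up in a uniform
    net of ]0, 1] with about 2 ln #|K| / lambda points ([deviation_net]), and
    moving to a larger u only decreases the bias term.
    A union bound over the net gives [uniform_deviation_tail]. Adding the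
    two classes gives a factor 4 ln #|H| / lambda + 2, which is at most
    8 ln #|H| / lambda when lambda < 1 because ln 2 >= 1/2; when lambda >= 1 the
    event is empty because all errors are in [0, 1].

    The event depends on a sample only through the finite table that records
    which hypothesis errs on which example. Hence it is measurable, and its
    probability is a finite sum ([power_probability_finite]); all the
    probability above is done for a weight function q on a finite type. *)

(** * Exponential inequalities *)

Lemma le_derive_nneg (R : realType) (f f' : R -> R) (t : R) :
  (forall x, is_derive x (1 : R) f (f' x)) ->
  (forall x, 0 < x -> 0 <= f' x) -> 0 <= t -> f 0 <= f t.
Proof.
move=> df f'_ge0 t_ge0; apply: (@ger0_derive1_ndecry R f 0) => [x _|x||//|//].
- by have [] := df x.
- rewrite in_itv/= andbT => x_gt0; have [_] := df x.
  by rewrite derive1E => ->; exact: f'_ge0.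
- apply: continuous_subspaceT => x; apply/differentiable_continuous.
  by apply/derivable1_diffP; have [] := df x.
Qed.

Lemma expR_tangent (R : realType) (x y : R) :
  expR x * (1 + (y - x)) <= expR y.
Proof.
have -> : expR y = expR x * expR (y - x) by rewrite -expRD subrKC.
by rewrite ler_wpM2l ?expR_ge0 ?expR_ge1Dx.
Qed.

(** Convexity of the exponential between 0 and y, obtained by averaging the tangent
    line at a * y. *)
Lemma expR_chord (R : realType) (a y : R) : 0 <= a <= 1 ->
  expR (a * y) <= 1 - a + a * expR y.
Proof.
move=> /andP[a0 a1].
have h1 := expR_tangent _ (a * y) y.
have h2 := expR_tangent _ (a * y) 0; rewrite expR0 in h2.
have -> : expR (a * y) = (1 - a) * (expR (a * y) * (1 + (0 - a * y))) +
  a * (expR (a * y) * (1 + (y - a * y))) by ring.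
by rewrite lerD// ?ler_wpM2l// -[leRHS]mulr1 ler_wpM2l// subr_ge0.
Qed.

(** Hoeffding's lemma for a Bernoulli variable. The log moment generating function
    ln Z has derivative [tilt], the mean of the exponentially tilted Bernoulli
    variable, and second derivative tilt * (1 - tilt), its variance, at most 1/4.
    Two integrations from 0 bound ln Z by t * p + t^2 / 8. *)
Lemma bernoulli_mgf_le (R : realType) (p t : R) : 0 <= p <= 1 -> 0 <= t ->
  1 - p + p * expR t <= expR (t * p + t ^+ 2 / 8).
Proof.
move=> /andP[p0 p1] t0.
pose Z (x : R) := 1 - p + p * expR x.
have Z_gt0 x : 0 < Z x.
  have := expR_gt0 x; rewrite /Z; have [->|pn] := eqVneq p 0; first lra.
  have p_gt0 : 0 < p by rewrite lt_def pn.
  by move=> /(mulr_gt0 p_gt0); lra.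
have dZ (x : R) : is_derive x (1 : R) Z (p * expR x).
  by rewrite /Z; apply: is_derive_eq; rewrite /GRing.scale/=; ring.
pose tilt (x : R) := p * expR x / Z x.
have dtilt (x : R) : is_derive x (1 : R) tilt (tilt x * (1 - tilt x)).
  have Zx0 : Z x != 0 by rewrite gt_eqF.
  have dV : is_derive x (1 : R) (fun y => (Z y)^-1) (- (Z x) ^- 2 * (p * expR x)).
    by apply: is_derive_eq; rewrite /GRing.scale/=; ring.
  rewrite /tilt; apply: is_derive_eq; rewrite /GRing.scale/=.
  have -> : p * expR x = Z x - (1 - p) by rewrite /Z; ring.
  by field.
have dlnZ (x : R) : is_derive x (1 : R) (@ln R \o Z) (tilt x).
  have dl := is_derive1_ln (Z_gt0 x).
  by apply: is_derive_eq; rewrite /GRing.scale/= /tilt; ring.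
pose g (x : R) := x / 4 + p - tilt x.
have dg (x : R) : is_derive x (1 : R) g (4^-1 - tilt x * (1 - tilt x)).
  by rewrite /g; apply: is_derive_eq; rewrite /GRing.scale/=; ring.
have g0 : g 0 = 0 by rewrite /g /tilt /Z expR0; field; lra.
have g_ge0 x : 0 < x -> 0 <= g x.
  move=> x0; rewrite -g0; apply: (le_derive_nneg _ _ _ _ dg); last exact: ltW.
  by move=> y _; have := sqr_ge0 (tilt y - 2^-1); lra.
pose f (x : R) := x ^+ 2 / 8 + x * p - (@ln R \o Z) x.
have df (x : R) : is_derive x (1 : R) f (g x).
  by rewrite /f; apply: is_derive_eq; rewrite /GRing.scale/= /g; field.
have : f 0 <= f t by exact: (le_derive_nneg _ _ _ _ df).
rewrite /f /= /Z expR0 mulr1 subrK ln1 => fle.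
rewrite -[leLHS]lnK ?posrE ?Z_gt0// ler_expR; lra.
Qed.

(** * Expectations over samples from a finite type *)

Section finite_expectation.
Context {R : realType} {W : finType} (q : W -> R).

Definition mean (f : W -> R) : R := \sum_w q w * f w.

Definition expect m (F : m.-tuple W -> R) : R :=
  \sum_(t : m.-tuple W) (\prod_(i < m) q (tnth t i)) * F t.

Lemma expect0 (F : 0.-tuple W -> R) : expect 0 F = F [tuple].
Proof.
rewrite /expect (bigD1 [tuple])//= big_ord0 mul1r big1 ?addr0// => t.
by case/eqP; apply: val_inj; case: t => -[].
Qed.

Lemma expectS m (F : m.+1.-tuple W -> R) :
  expect m.+1 F = mean (fun w => expect m (fun t => F (cons_tuple w t))).
Proof.
rewrite /mean /expect.
under [RHS]eq_bigr do rewrite big_distrr/=.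
rewrite pair_big/= (reindex (fun p : W * m.-tuple W => cons_tuple p.1 p.2))/=.
  apply: eq_bigr => -[w t] _ /=; rewrite big_ord_recl mulrA; congr (_ * _ * _).
  by apply: eq_bigr => i _; rewrite tnthS.
exists (fun t => (thead t, behead_tuple t)) => [[w t] _|t _] /=.
  by congr (_, _); apply: val_inj.
by apply: val_inj; case/tupleP: t.
Qed.

Lemma eq_expect m (F G : m.-tuple W -> R) : F =1 G -> expect m F = expect m G.
Proof. by move=> FG; apply: eq_bigr => t _; rewrite FG. Qed.

Lemma expectD m (F G : m.-tuple W -> R) :
  expect m (fun t => F t + G t) = expect m F + expect m G.
Proof. by rewrite -big_split; apply: eq_bigr => t _; rewrite mulrDr. Qed.

Lemma expectZ m c (F : m.-tuple W -> R) :
  expect m (fun t => c * F t) = c * expect m F.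
Proof. by rewrite big_distrr; apply: eq_bigr => t _; rewrite mulrCA. Qed.

Lemma expectN m (F : m.-tuple W -> R) :
  expect m (fun t => - F t) = - expect m F.
Proof. by rewrite -mulN1r -expectZ; apply: eq_expect => t; rewrite mulN1r. Qed.

Lemma expect_sum m (I : Type) (r : seq I) (P : pred I)
    (F : I -> m.-tuple W -> R) :
  expect m (fun t => \sum_(i <- r | P i) F i t)
  = \sum_(i <- r | P i) expect m (F i).
Proof.
rewrite exchange_big; apply: eq_bigr => t _ /=.
by rewrite big_distrr.
Qed.

Context (q_ge0 : forall w, 0 <= q w) (q_sum1 : \sum_w q w = 1).

Lemma le_mean (f g : W -> R) : (forall w, f w <= g w) -> mean f <= mean g.
Proof. by move=> fg; apply: ler_sum => w _; rewrite ler_wpM2l. Qed.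

Lemma mean_affine (a b : R) (f : W -> R) :
  mean (fun w => a + b * f w) = a + b * mean f.
Proof.
rewrite /mean; under eq_bigr do rewrite mulrDr mulrCA.
by rewrite big_split/= -big_distrl -big_distrr/= q_sum1 mul1r.
Qed.

Lemma le_expect m (F G : m.-tuple W -> R) :
  (forall t, F t <= G t) -> expect m F <= expect m G.
Proof.
by move=> FG; apply: ler_sum => t _; rewrite ler_wpM2l// prodr_ge0.
Qed.

Lemma expect_cst m c : expect m (fun=> c) = c.
Proof.
elim: m => [|m IH]; first by rewrite expect0.
by rewrite expectS /mean IH -big_distrl/= q_sum1 mul1r.
Qed.

Lemma expect_affine m (a b : R) (F : m.-tuple W -> R) :
  expect m (fun t => a + b * F t) = a + b * expect m F.
Proof. by rewrite expectD expect_cst expectZ. Qed.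

Lemma expect_tnth m (i : 'I_m) (f : W -> R) :
  expect m (fun t => f (tnth t i)) = mean f.
Proof.
elim: m i => [[]//|m IH] i; rewrite expectS.
case: (unliftP ord0 i) => [j ->|->]; last first.
  apply: eq_bigr => w _; congr (_ * _); rewrite -[RHS](expect_cst m).
  by apply: eq_expect => t; rewrite tnth0.
under [LHS]eq_bigr => w _ do under eq_expect do rewrite tnthS.
by rewrite IH -big_distrl/= q_sum1 mul1r.
Qed.

(** Convexity of exp reduces a variable of range c to the two-point variable with
    the same mean on the end points of its range. *)
Lemma hoeffding_mgf (f : W -> R) (c theta : R) : 0 < c -> 0 <= theta ->
  (forall v w, f v - f w <= c) ->
  mean (fun w => expR (theta * (f w - mean f)))
  <= expR (theta ^+ 2 * c ^+ 2 / 8).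
Proof.
move=> c0 theta0 fc.
have [w0 _] : exists w0 : W, true.
  case: (pickP (@predT W)) => [w|W0]; first by exists w.
  by move: q_sum1; rewrite big_pred0// => /eqP; rewrite eq_sym oner_eq0.
pose a := f [arg min_(w < w0) f w]%O.
have a_le w : a <= f w by rewrite /a; case: Order.TotalTheory.arg_minP => // i _ ->.
pose y w := (f w - a) / c.
have y01 w : 0 <= y w <= 1.
  by rewrite /y ler_pdivrMr// mul1r fc divr_ge0 ?subr_ge0// ltW.
have fE w : f w = a + c * y w by rewrite /y; field; rewrite gt_eqF.
have mfE : mean f = a + c * mean y.
  by rewrite -mean_affine; apply: eq_bigr => w _; rewrite -fE.
have my01 : 0 <= mean y <= 1.
  have := mean_affine 0 0 y; have := mean_affine 1 0 y; rewrite !mul0r !addr0.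
  move=> m1 m0; rewrite -[X in X <= mean y]m0 -[X in _ && (_ <= X)]m1.
  by rewrite !le_mean// => w; have /andP[] := y01 w; rewrite mul0r addr0.
set p := mean y in mfE my01 *.
have tc0 : 0 <= theta * c by rewrite mulr_ge0// ltW.
have -> : mean (fun w => expR (theta * (f w - mean f)))
        = mean (fun w => 0 + expR (- (theta * c * p)) * expR (y w * (theta * c))).
  apply: eq_bigr => w _; rewrite add0r -expRD mfE {1}fE; congr (_ * expR _).
  by ring.
rewrite mean_affine add0r.
have -> : theta ^+ 2 * c ^+ 2 / 8 =
  - (theta * c * p) + (theta * c * p + (theta * c) ^+ 2 / 8) by field.
rewrite expRD ler_wpM2l ?expR_ge0//.
apply: le_trans (bernoulli_mgf_le _ _ _ my01 tc0).
have -> : 1 - p + p * expR (theta * c) = 1 + (expR (theta * c) - 1) * p by ring.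
rewrite -mean_affine; apply: le_mean => w.
have -> : 1 + (expR (theta * c) - 1) * y w = 1 - y w + y w * expR (theta * c).
  by ring.
exact: expR_chord.
Qed.

(** The bounded differences condition: stated for the Hamming distance rather than
    for one coordinate at a time, it passes directly to functions that depend
    Lipschitz-continuously on several such functions, and to sections. *)
Definition hamming_lipschitz m (c : R) (F : m.-tuple W -> R) :=
  forall t t', F t - F t' <= c * \sum_(i < m) (tnth t i != tnth t' i)%:R.

Lemma hamming_lipschitzN m c (F : m.-tuple W -> R) :
  hamming_lipschitz m c F -> hamming_lipschitz m c (fun t => - F t).
Proof.
move=> lipF t t'; rewrite opprK addrC; apply: le_trans (lipF t' t) _.
by under eq_bigr do rewrite eq_sym.
Qed.

(** Doob's martingale, one coordinate at a time: conditionally on the first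
    coordinate w, the induction hypothesis compares F with its conditional mean
    [G w], and [G] itself has range at most c, so [hoeffding_mgf] applies. *)
Lemma mcdiarmid_mgf m (F : m.-tuple W -> R) (c theta : R) :
  0 < c -> 0 <= theta -> hamming_lipschitz m c F ->
  expect m (fun t => expR (theta * (F t - expect m F)))
  <= expR (theta ^+ 2 * c ^+ 2 / 8 * m%:R).
Proof.
move=> c0 theta0; elim: m F => [|m IH] F lipF.
  by rewrite !expect0 subrr mulr0 mulr0.
pose F_ w (t : m.-tuple W) := F (cons_tuple w t).
pose G w := expect m (F_ w).
have EF : expect m.+1 F = mean G by rewrite expectS.
rewrite EF expectS -[m.+1%:R]natr1 mulrDr mulr1 addrC expRD.
apply: (@le_trans _ _ (mean (fun w => 0 +
    expR (theta ^+ 2 * c ^+ 2 / 8 * m%:R) * expR (theta * (G w - mean G))))).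
  apply: le_mean => w.
  have lipFw : hamming_lipschitz m c (F_ w).
    move=> t t'; apply: le_trans (lipF _ _) _; rewrite big_ord_recl/=.
    rewrite !tnth0 eqxx add0r; under eq_bigr do rewrite !tnthS.
    exact: lexx.
  rewrite add0r; apply: le_trans (ler_wpM2r (expR_ge0 _) (IH _ lipFw)).
  rewrite mulrC -expectZ; apply: le_expect => t.
  rewrite -expRD ler_expR le_eqVlt; apply/orP; left; apply/eqP;
  by rewrite /G /F_; ring.
rewrite mean_affine add0r mulrC ler_wpM2r ?expR_ge0//.
apply: hoeffding_mgf => // v w.
rewrite -[c](expect_cst m) -[X in _ - X]mul1r -mulNr -expectZ -expectD.
apply: le_expect => t; rewrite mulN1r; apply: le_trans (lipF _ _) _.
rewrite big_ord_recl !tnth0 big1 ?addr0; last by move=> i _; rewrite !tnthS eqxx.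
by rewrite -[leRHS]mulr1 ler_wpM2l ?(ltW c0)// lern1 leq_b1.
Qed.

(** Chernoff's method applied to [mcdiarmid_mgf]. *)
Lemma mcdiarmid m (F : m.-tuple W -> R) (c tau : R) :
  (0 < m)%N -> 0 < c -> 0 <= tau -> hamming_lipschitz m c F ->
  expect m (fun t => (tau <= F t - expect m F)%R%:R)
  <= expR (- (2 * tau ^+ 2 / (m%:R * c ^+ 2))).
Proof.
move=> m0 c0 tau0 lipF.
have mR0 : 0 < m%:R :> R by rewrite ltr0n.
(* the minimizer of - theta * tau + theta^2 * c^2 * m / 8 *)
pose theta := 4 * tau / (m%:R * c ^+ 2).
have theta0 : 0 <= theta.
  by rewrite divr_ge0 ?mulr_ge0 ?exprn_ge0 ?(ltW c0).
apply: (@le_trans _ _ (expR (- (theta * tau)) *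
    expect m (fun t => expR (theta * (F t - expect m F))))).
  rewrite -expectZ; apply: le_expect => t; rewrite -expRD.
  case: (leP tau) => [tauF|_]; last exact: expR_ge0.
  rewrite -expR0 ler_expR -mulrN -mulrDr mulr_ge0//; lra.
apply: le_trans (ler_wpM2l (expR_ge0 _) (mcdiarmid_mgf _ _ _ _ c0 theta0 lipF)) _.
rewrite -expRD ler_expR le_eqVlt; apply/orP; left; apply/eqP.
by rewrite /theta; field; rewrite !gt_eqF.
Qed.

End finite_expectation.

(** * Normalized log-partition functions *)

Section log_partition.
Context {R : realType} {I : finType} (K : pred I).

Definition partition_fun (eta : R) (e : I -> R) : R :=
  \sum_(i | K i) expR (- eta * e i).

Definition log_partition (eta : R) (e : I -> R) : R :=
  eta^-1 * ln (partition_fun eta e).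

Context (i0 : I) (Ki0 : K i0).

Lemma partition_fun_gt0 eta e : 0 < partition_fun eta e.
Proof.
by rewrite /partition_fun (bigD1 i0)//= ltr_pwDl ?expR_gt0// sumr_ge0.
Qed.

Let Kgt0 : 0 < #|K|%:R :> R.
Proof. by rewrite ltr0n; apply/card_gt0P; exists i0. Qed.

Lemma ln_card_ge0 : 0 <= ln (#|K|%:R : R).
Proof. by rewrite ln_ge0// ler1n -(ltr0n R) Kgt0. Qed.

Lemma log_partition_lipschitz (eta c : R) (e e' : I -> R) : 0 < eta ->
  (forall i, e' i - e i <= c) ->
  log_partition eta e - log_partition eta e' <= c.
Proof.
move=> eta0 ec; rewrite /log_partition -mulrBr ler_pdivrMl//.
rewrite lerBlDr -[eta * c]expRK -lnM ?posrE ?expR_gt0 ?partition_fun_gt0//.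
rewrite ler_ln ?posrE ?mulr_gt0 ?expR_gt0 ?partition_fun_gt0//.
rewrite /partition_fun big_distrr/=; apply: ler_sum => i _.
rewrite -expRD ler_expR; have := ec i => /(ler_wpM2l (ltW eta0)); lra.
Qed.

(** A supporting hyperplane at e, which exists by convexity of log-sum-exp. Its
    slope is minus the Gibbs distribution of e. *)
Lemma log_partition_tangent (eta : R) (e : I -> R) : 0 < eta ->
  exists p : I -> R, forall e', log_partition eta e
    - \sum_(i | K i) p i * (e' i - e i) <= log_partition eta e'.
Proof.
move=> eta0; pose Z := partition_fun eta e.
have Z0 : 0 < Z by exact: partition_fun_gt0.
pose p i := expR (- eta * e i) / Z; exists p => e'.
have p0 i : 0 <= p i by rewrite divr_ge0 ?expR_ge0 ?ltW.
have p1 : \sum_(i | K i) p i = 1 by rewrite -big_distrl/= divff// gt_eqF.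
pose c := \sum_(i | K i) p i * (- eta * (e' i - e i)).
have -> : \sum_(i | K i) p i * (e' i - e i) = eta^-1 * - c.
  rewrite /c -sumrN big_distrr/=; apply: eq_bigr => i _.
  by field; rewrite gt_eqF.
rewrite /log_partition mulrN opprK -mulrDr ler_wpM2l ?invr_ge0 ?(ltW eta0)//.
rewrite -/Z -[c]expRK -lnM ?posrE ?expR_gt0//.
rewrite ler_ln ?posrE ?mulr_gt0 ?expR_gt0 ?partition_fun_gt0//.
have -> : partition_fun eta e'
    = Z * \sum_(i | K i) p i * expR (- eta * (e' i - e i)).
  rewrite /partition_fun big_distrr/=; apply: eq_bigr => i _.
  rewrite mulrA /p mulrCA divff ?gt_eqF// mulr1 -expRD; congr expR; ring.
rewrite ler_wpM2l ?(ltW Z0)//.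
apply: (@le_trans _ _ (\sum_(i | K i)
    p i * (expR c * (1 + (- eta * (e' i - e i) - c))))); last first.
  by apply: ler_sum => i _; rewrite ler_wpM2l// expR_tangent.
have -> : \sum_(i | K i) p i * (expR c * (1 + (- eta * (e' i - e i) - c)))
    = expR c * ((1 - c) * (\sum_(i | K i) p i)
        + \sum_(i | K i) p i * (- eta * (e' i - e i))).
  rewrite [(1 - c) * _]big_distrr -big_split big_distrr/=.
  by apply: eq_bigr => i _; ring.
by rewrite p1 mulr1 -/c subrK mulr1.
Qed.

(** This and the next lemma compare the l^p quasi-norms of the weights
    expR (- eta' * e i), for p = 1 and for p = a = eta / eta' <= 1. Here: after
    normalization the weights sum to 1, so each is at most 1, and the power a
    does not decrease it. *)
Lemma log_partition_nincr (eta eta' : R) (e : I -> R) : 0 < eta -> eta <= eta' ->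
  log_partition eta' e <= log_partition eta e.
Proof.
move=> eta0 le_eta; have eta'0 : 0 < eta' by exact: lt_le_trans le_eta.
pose L := ln (partition_fun eta' e); pose a := eta / eta'.
have a01 : 0 <= a <= 1.
  by rewrite divr_ge0 ?(ltW eta0) ?(ltW eta'0)//= ler_pdivrMr ?mul1r.
have Z1 : \sum_(i | K i) expR (- eta' * e i - L) = 1.
  under eq_bigr do rewrite expRB.
  by rewrite -big_distrl/= lnK ?posrE ?partition_fun_gt0// divff// gt_eqF//
             partition_fun_gt0.
have yle0 i : K i -> - eta' * e i - L <= 0.
  by move=> Ki; rewrite -expR_le1 -Z1 (bigD1 i)//= lerDl sumr_ge0.
have aL : a * L <= ln (partition_fun eta e).
  rewrite -[a * L]expRK ler_ln ?posrE ?expR_gt0 ?partition_fun_gt0//.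
  rewrite -[leLHS]mulr1 -Z1 big_distrr/=; apply: ler_sum => i Ki.
  rewrite -expRD ler_expR.
  have -> : - eta * e i = a * L + a * (- eta' * e i - L).
    by rewrite /a; field; rewrite gt_eqF.
  have /andP[a0 a1] := a01; have := yle0 _ Ki; nra.
rewrite /log_partition -/L ler_pdivlMl//.
by apply: le_trans aL; rewrite /a mulrA.
Qed.

(** The power mean inequality: after normalization the weights have average 1, and
    y^a <= 1 - a + a * y. *)
Lemma log_partition_incr_le (eta eta' : R) (e : I -> R) :
  0 < eta -> eta <= eta' ->
  log_partition eta e <= log_partition eta' e + (eta^-1 - eta'^-1) * ln (#|K|%:R).
Proof.
move=> eta0 le_eta; have eta'0 : 0 < eta' by exact: lt_le_trans le_eta.
pose n : R := #|K|%:R; have n0 : 0 < n by exact: Kgt0.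
pose L := ln (partition_fun eta' e) - ln n; pose a := eta / eta'.
have a01 : 0 <= a <= 1.
  by rewrite divr_ge0 ?(ltW eta0) ?(ltW eta'0)//= ler_pdivrMr ?mul1r.
have Zn : \sum_(i | K i) expR (- eta' * e i - L) = n.
  under eq_bigr do rewrite expRB.
  rewrite -big_distrl/= /L expRB !lnK ?posrE ?partition_fun_gt0//.
  by rewrite invf_div mulrCA divff ?mulr1// gt_eqF// partition_fun_gt0.
have Zle : partition_fun eta e <= expR (a * L) * n.
  have -> : partition_fun eta e
      = expR (a * L) * \sum_(i | K i) expR (a * (- eta' * e i - L)).
    rewrite big_distrr/=; apply: eq_bigr => i _; rewrite -expRD; congr expR.
    by rewrite /a; field; rewrite gt_eqF.
  rewrite ler_wpM2l ?expR_ge0//.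
  apply: (@le_trans _ _
      (\sum_(i | K i) (1 - a + a * expR (- eta' * e i - L)))).
    by apply: ler_sum => i _; exact: expR_chord.
  rewrite big_split/= -big_distrr/= Zn sumr_const -[_ *+ _]mulr_natr -/n.
  by rewrite -mulrDl subrK mul1r.
have lnZ : ln (partition_fun eta e) <= a * L + ln n.
  rewrite -{1}[a * L]expRK -lnM ?posrE ?expR_gt0//.
  by rewrite ler_ln ?posrE ?mulr_gt0 ?expR_gt0 ?partition_fun_gt0.
rewrite /log_partition ler_pdivrMl//; apply: le_trans lnZ _.
rewrite le_eqVlt; apply/orP; left; apply/eqP; rewrite /a /L -/n.
by field; rewrite !gt_eqF.
Qed.

End log_partition.

(** The points (k+1)/N of a uniform net of ]0, 1]: each 1/eta is approximated from
    above, that is, eta from below. *)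
Lemma inverse_net (R : realType) (N : nat) (eta : R) : (0 < N)%N -> 1 <= eta ->
  exists k : 'I_N, [/\ 0 < N%:R / k.+1%:R :> R, N%:R / k.+1%:R <= eta &
    (N%:R / k.+1%:R)^-1 - eta^-1 <= N%:R^-1].
Proof.
case: N => // N _ eta1; have eta0 : 0 < eta by exact: lt_le_trans eta1.
have u0 : 0 <= N.+1%:R / eta by rewrite divr_ge0// ltW.
pose j := Num.trunc (N.+1%:R / eta).
have /andP[jle ltj] := Num.Theory.truncn_itv u0; rewrite -/j in jle ltj.
have N0 : 0 < N.+1%:R :> R by rewrite ltr0n.
have [jN|Nj] := ltnP j N.+1.
  have j0 : 0 < j.+1%:R :> R by rewrite ltr0n.
  exists (Ordinal jN); split => /=; first by rewrite divr_gt0.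
    by rewrite ler_pdivrMr// mulrC -ler_pdivrMr// ltW.
  rewrite invf_div lerBlDr ler_pdivrMr// mulrDl mulVf ?gt_eqF//.
  by rewrite -natr1 addrC lerD2l mulrC.
(* N / eta = N, that is, eta = 1 *)
exists ord_max; split => /=; first by rewrite divff ?gt_eqF.
  by rewrite divff ?gt_eqF.
have -> : eta = 1.
  apply: le_anti; rewrite eta1 andbT.
  have : N.+1%:R <= N.+1%:R / eta by apply: le_trans jle; rewrite ler_nat.
  by rewrite ler_pdivlMr// ger_pMr.
by rewrite divff ?gt_eqF// subrr invr_ge0 ltW.
Qed.

(** * Deviations of empirical log-partition functions *)

Section empirical_process.
Context {R : realType} {W : finType} (q : W -> R).
Context {I : finType} (g : I -> W -> R) {m : nat}.

Definition risk (i : I) : R := mean q (g i).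

Definition empirical_risk (t : m.-tuple W) (i : I) : R :=
  m%:R^-1 * \sum_(k < m) g i (tnth t k).

(** Both signs of the deviation, with the bias eta / (8 * m) removed on the side
    where the mean of the empirical value is off by that much. *)
Definition deviation (K : pred I) (b : bool) (eta : R) (t : m.-tuple W) : R :=
  if b then log_partition K eta risk - log_partition K eta (empirical_risk t)
  else log_partition K eta (empirical_risk t) - log_partition K eta risk
       - eta / (8 * m%:R).

Context (q_ge0 : forall w, 0 <= q w) (q_sum1 : \sum_w q w = 1).
Context (g01 : forall i w, 0 <= g i w <= 1) (m_gt0 : (0 < m)%N).

Let mR_gt0 : 0 < m%:R :> R. Proof. by rewrite ltr0n. Qed.

Lemma risk01 i : 0 <= risk i <= 1.
Proof.
have := mean_affine q q_sum1 0 0 (g i); have := mean_affine q q_sum1 1 0 (g i).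
rewrite !mul0r !addr0 => m1 m0.
rewrite /risk -[X in X <= _]m0 -[X in _ && (_ <= X)]m1.
by rewrite !le_mean// => w; have /andP[] := g01 i w; rewrite mul0r addr0.
Qed.

Lemma empirical_risk01 t i : 0 <= empirical_risk t i <= 1.
Proof.
rewrite /empirical_risk mulr_ge0 ?invr_ge0 ?(ltW mR_gt0)//=; last first.
  by rewrite sumr_ge0// => k _; have /andP[] := g01 i (tnth t k).
rewrite ler_pdivrMl// mulr1 -[X in _ <= X%:R](card_ord m) -sumr_const.
by apply: ler_sum => k _; have /andP[] := g01 i (tnth t k).
Qed.

Lemma expect_empirical_risk i : expect q m (fun t => empirical_risk t i) = risk i.
Proof.
rewrite expectZ (expect_sum q m _ _ _ (fun k t => g i (tnth t k))).
under eq_bigr do rewrite expect_tnth//.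
by rewrite sumr_const card_ord -(mulr_natl (mean q (g i))) mulKf// gt_eqF.
Qed.

Lemma empirical_risk_lipschitz i :
  hamming_lipschitz m m%:R^-1 (fun t => empirical_risk t i).
Proof.
move=> t t'; rewrite -mulrBr ler_wpM2l ?invr_ge0 ?(ltW mR_gt0)//.
rewrite -sumrB; apply: ler_sum => k _; case: eqVneq => [->|_].
  by rewrite subrr.
have /andP[_] := g01 i (tnth t k); have /andP[] := g01 i (tnth t' k).
by rewrite mulr1n; lra.
Qed.

Context (K : pred I) (i0 : I) (Ki0 : K i0).

Lemma log_partition_emp_lipschitz eta : 0 < eta ->
  hamming_lipschitz m m%:R^-1 (fun t => log_partition K eta (empirical_risk t)).
Proof.
move=> eta0 t t'; apply: (log_partition_lipschitz K i0 Ki0) => // i.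
apply: le_trans (empirical_risk_lipschitz i _ _) _.
by under eq_bigr do rewrite eq_sym.
Qed.

(** Integrate the supporting hyperplane at [risk]: its linear part has mean 0 as the
    empirical risk is unbiased. *)
Lemma log_partition_risk_le eta : 0 < eta -> log_partition K eta risk
  <= expect q m (fun t => log_partition K eta (empirical_risk t)).
Proof.
move=> eta0; have [p tangent] := log_partition_tangent K i0 Ki0 eta risk eta0.
apply: le_trans (le_expect q q_ge0 m _ _ (fun t => tangent (empirical_risk t))).
rewrite expectD expect_cst// -[leLHS]addr0 lerD2l.
under eq_expect do rewrite -mulN1r.
rewrite expectZ (expect_sum q m _ _ _ (fun i t => p i * (empirical_risk t i - risk i))).
rewrite big1 ?mulr0// => i _.
by rewrite expectZ expectD expect_cst// expect_empirical_risk subrr mulr0.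
Qed.

(** Each term of the empirical partition function has mean at most
    expR (eta^2 / (8 m)) times the true one, by [mcdiarmid_mgf] applied to minus
    the empirical risk; the concavity of ln does the rest. *)
Lemma expect_log_partition_le eta : 0 < eta ->
  expect q m (fun t => log_partition K eta (empirical_risk t))
  <= log_partition K eta risk + eta / (8 * m%:R).
Proof.
move=> eta0; pose x := eta ^+ 2 / (8 * m%:R).
pose Zr := partition_fun K eta risk.
have Zr0 : 0 < Zr by exact: (partition_fun_gt0 K i0).
pose c := expR x * Zr; have c0 : 0 < c by rewrite mulr_gt0 ?expR_gt0.
have EZ : expect q m (fun t => partition_fun K eta (empirical_risk t)) <= c.
  rewrite (expect_sum q m _ _ _ (fun i t => expR (- eta * empirical_risk t i))).
  rewrite /c /Zr /partition_fun big_distrr/=; apply: ler_sum => i _.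
  pose F (t : m.-tuple W) := - empirical_risk t i.
  have EF : expect q m F = - risk i.
    by rewrite expectN expect_empirical_risk.
  have lipF : hamming_lipschitz m m%:R^-1 F.
    exact/hamming_lipschitzN/empirical_risk_lipschitz.
  have := mcdiarmid_mgf q q_ge0 q_sum1 m F _ eta _ (ltW eta0) lipF.
  rewrite invr_gt0 => /(_ mR_gt0) mgf.
  have -> : x = eta ^+ 2 * m%:R^-1 ^+ 2 / 8 * m%:R.
    by rewrite /x; field; rewrite gt_eqF.
  apply: le_trans (ler_wpM2r (expR_ge0 _) mgf).
  rewrite mulrC -expectZ; apply: le_expect => // t.
  by rewrite -expRD ler_expR EF /F; lra.
(* the tangent line of ln at c *)
apply: (@le_trans _ _ (eta^-1 * (ln c - 1) + eta^-1 * c^-1 * c)); last first.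
  have -> : eta^-1 * (ln c - 1) + eta^-1 * c^-1 * c = eta^-1 * ln c.
    by field; rewrite !gt_eqF.
  rewrite /c lnM ?posrE ?expR_gt0// expRK mulrDr addrC.
  rewrite lerD2l /x le_eqVlt; apply/orP; left; apply/eqP.
  by field; rewrite !gt_eqF.
apply: (@le_trans _ _ (eta^-1 * (ln c - 1) + eta^-1 * c^-1 *
    expect q m (fun t => partition_fun K eta (empirical_risk t)))); last first.
  by rewrite lerD2l ler_wpM2l ?mulr_ge0 ?invr_ge0 ?(ltW eta0) ?(ltW c0).
rewrite -expect_affine//; apply: le_expect => // t.
rewrite -mulrA -mulrDr ler_wpM2l ?invr_ge0 ?(ltW eta0)//.
set Z := partition_fun K eta _; have Z0 : 0 < Z by exact: (partition_fun_gt0 K i0).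
have : ln (1 + (Z / c - 1)) <= Z / c - 1.
  by apply: le_ln1Dx; rewrite ltrBrDr addNr divr_gt0.
rewrite addrC subrK ln_div ?posrE// [c^-1 * Z]mulrC; lra.
Qed.

Lemma deviation_tail b eta tau : 0 < eta -> 0 <= tau ->
  expect q m (fun t => (tau <= deviation K b eta t)%R%:R)
  <= expR (- (2 * tau ^+ 2 * m%:R)).
Proof.
move=> eta0 tau0; pose F (t : m.-tuple W) := log_partition K eta (empirical_risk t).
have lipF : hamming_lipschitz m m%:R^-1 F by exact: log_partition_emp_lipschitz.
have im0 : 0 < m%:R^-1 :> R by rewrite invr_gt0.
have -> : 2 * tau ^+ 2 * m%:R = 2 * tau ^+ 2 / (m%:R * m%:R^-1 ^+ 2).
  by field; rewrite gt_eqF.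
case: b; last first.
  apply: le_trans (mcdiarmid q q_ge0 q_sum1 m F _ tau m_gt0 im0 tau0 lipF).
  apply: le_expect => // t; rewrite ler_nat /deviation.
  have := expect_log_partition_le eta eta0; rewrite -/F => EF.
  case: (leP tau) => // tauF; rewrite lt0b; move: tauF; rewrite -/(F t); lra.
pose F' (t : m.-tuple W) := - F t.
have EF' : expect q m F' = - expect q m F.
  exact: expectN.
have lipF' : hamming_lipschitz m m%:R^-1 F'.
  exact: hamming_lipschitzN.
apply: le_trans (mcdiarmid q q_ge0 q_sum1 m F' _ tau m_gt0 im0 tau0 lipF').
apply: le_expect => // t; rewrite ler_nat /deviation EF' /F'.
have := log_partition_risk_le eta eta0; rewrite -/F => EF.
case: (leP tau) => // tauF; rewrite lt0b; move: tauF; rewrite -/(F t); lra.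
Qed.

(** The true and the empirical values both move up, and by at most lambda / 2, when
    1/eta is rounded up to the net; so their difference moves by at most lambda / 2
    and the bias term decreases. *)
Lemma deviation_net (b : bool) (eta lambda : R) (N : nat) (t : m.-tuple W) :
  (0 < N)%N -> 1 <= eta -> ln (#|K|%:R) <= lambda / 2 * N%:R ->
  lambda <= deviation K b eta t ->
  exists k : 'I_N, lambda / 2 <= deviation K b (N%:R / k.+1%:R) t.
Proof.
move=> N0 eta1 lnN; have [k [net0 net_le net_inv]] := inverse_net R N eta N0 eta1.
have NR0 : 0 < N%:R :> R by rewrite ltr0n.
set eta' := _ / _ in net0 net_le net_inv; move=> dev; exists k.
rewrite -/eta'; move: dev; rewrite /deviation.
have shift e : log_partition K eta e <= log_partition K eta' e
    <= log_partition K eta e + lambda / 2.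
  rewrite (log_partition_nincr K i0 Ki0)//=.
  apply: le_trans (log_partition_incr_le K i0 Ki0 _ _ _ net0 net_le) _.
  rewrite lerD2l; apply: le_trans (ler_wpM2r (ln_card_ge0 K i0 Ki0) net_inv) _.
  by rewrite ler_pdivrMl// mulrC.
have /andP[r1 r2] := shift risk; have /andP[e1 e2] := shift (empirical_risk t).
have bias : eta' / (8 * m%:R) <= eta / (8 * m%:R).
  by rewrite ler_wpM2r// invr_ge0 mulr_ge0// ltW.
by case: b; lra.
Qed.

(** Union bound over the net. The event is given by any predicate [B] that implies
    a deviation, so that the caller chooses how to express it. *)
Lemma uniform_deviation_tail (b : bool) (lambda : R) (B : pred (m.-tuple W)) :
  0 < lambda ->
  (forall t, B t -> exists2 eta, 1 <= eta & lambda <= deviation K b eta t) ->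
  expect q m (fun t => (B t)%:R)
  <= (2 * ln (#|K|%:R) / lambda + 1) * expR (- (lambda ^+ 2 * m%:R / 2)).
Proof.
move=> lambda0 Bdev; pose x := 2 * ln (#|K|%:R) / lambda : R.
have x0 : 0 <= x by rewrite divr_ge0 ?mulr_ge0 ?(ln_card_ge0 K i0)// ltW.
have /andP[trunc_le lt_trunc] := Num.Theory.truncn_itv x0.
pose N := (Num.trunc x).+1.
have lnN : ln (#|K|%:R) <= lambda / 2 * N%:R.
  move: lt_trunc; rewrite -/N ltr_pdivrMr// => /ltW; lra.
apply: (@le_trans _ _ (expect q m (fun t => \sum_(k < N)
    (lambda / 2 <= deviation K b (N%:R / k.+1%:R) t)%R%:R))).
  apply: le_expect => // t; case Bt : (B t) => /=; last by rewrite sumr_ge0.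
  have [eta eta1 dev] := Bdev _ Bt.
  have [k devk] := deviation_net b eta lambda N t (ltn0Sn _) eta1 lnN dev.
  by rewrite (bigD1 k)//= devk lerDl sumr_ge0.
rewrite (expect_sum q m _ _ _
  (fun (k : 'I_N) t => (lambda / 2 <= deviation K b (N%:R / k.+1%:R) t)%R%:R)).
apply: (@le_trans _ _ (\sum_(k < N) expR (- (lambda ^+ 2 * m%:R / 2)))).
  apply: ler_sum => k _; have -> : lambda ^+ 2 * m%:R / 2
      = 2 * (lambda / 2) ^+ 2 * m%:R by field.
  by apply: deviation_tail; rewrite ?divr_gt0 ?divr_ge0 ?ltr0n ?(ltW lambda0).
rewrite sumr_const card_ord -(mulr_natl (expR _)) ler_wpM2r ?expR_ge0//.
by rewrite /N -natr1 lerD2r.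
Qed.

End empirical_process.

(** * The log ratio for a finite class of losses *)

Section log_ratio_tail.
Context {R : realType} {W : finType} (q : W -> R).
Context {I : finType} (g : I -> W -> R) {m : nat}.
Context (q_ge0 : forall w, 0 <= q w) (q_sum1 : \sum_w q w = 1).
Context (g01 : forall i w, 0 <= g i w <= 1) (m_gt0 : (0 < m)%N).

(** A deviation 2 * lambda + eta / (8 * m) of the ratio is the sum of the two
    deviations of opposite signs of [P] and of its complement, plus one bias term;
    hence one of the two deviations is at least lambda. *)
Lemma log_ratio_deviation_tail (P : pred I) (s lambda : R)
    (B : pred (m.-tuple W)) :
  (exists i, P i) -> (exists i, ~~ P i) -> s = 1 \/ s = -1 -> 0 < lambda ->
  let ratio e eta := log_partition P eta e
    - log_partition (fun i => ~~ P i) eta e in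
  (forall t, B t -> exists2 eta, 1 <= eta & 2 * lambda + eta / (8 * m%:R)
    <= s * (ratio (risk q g) eta - ratio (empirical_risk g t) eta)) ->
  expect q m (fun t => (B t)%:R)
  <= 8 * ln (#|I|%:R) / lambda * expR (- (lambda ^+ 2 * m%:R / 2)).
Proof.
move=> [ip Pip] [ineg Pin] s_sign lambda0 ratio Bdev.
set N := fun i => ~~ P i in ratio Bdev *.
have card2 : (1 < #|I|)%N.
  apply/card_gt1P; exists ip, ineg; split=> //.
  by apply: contraNneq Pin => <-.
have lnI : 2^-1 <= ln (#|I|%:R : R).
  have : 2^-1 <= ln (2 : R).
    have : ln (1 + - 2^-1 : R) <= - 2^-1 by apply: le_ln1Dx; lra.
    have -> : 1 + - 2^-1 = 2^-1 :> R by lra.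
    by rewrite lnV ?posrE ?ltr0n//; lra.
  move=> /le_trans; apply.
  by rewrite ler_ln ?posrE ?ltr0n ?ler_nat// ltnW.
have ln_card_le (K : pred I) i : K i -> ln (#|K|%:R) <= ln (#|I|%:R : R).
  move=> Ki; have K0 : (0 < #|K|)%N by apply/card_gt0P; exists i.
  by rewrite ler_ln ?posrE ?ltr0n ?ler_nat ?(ltnW card2)// max_card.
(* for lambda >= 1, each of the two differences is at most 1 in absolute value *)
have [lambda1|lambda1] := leP 1 lambda.
  have B0 t : B t = false.
    apply: negbTE; apply/negP => /Bdev[eta eta1]; apply/negP; rewrite -ltNge.
    have eta0 : 0 < eta by exact: lt_le_trans eta1.
    have bias : 0 < eta / (8 * m%:R) by rewrite divr_gt0 ?mulr_gt0 ?ltr0n.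
    have lip (K : pred I) i : K i -> `|log_partition K eta (risk q g)
        - log_partition K eta (empirical_risk g t)| <= 1.
      move=> Ki; rewrite ler_norml lerNl opprB.
      by apply/andP; split; apply: (log_partition_lipschitz K i Ki) => // j;
         have := risk01 q g q_ge0 q_sum1 g01 j;
         have := empirical_risk01 g g01 m_gt0 t j; lra.
    have := lip P ip Pip; have := lip N ineg Pin; rewrite !ler_norml /ratio.
    by case: s_sign => ->; lra.
  apply: (@le_trans _ _ (expect q m (fun=> 0))).
    by apply: le_expect => // t; rewrite B0.
  by rewrite expect_cst// mulr_ge0 ?expR_ge0// divr_ge0 ?mulr_ge0 ?(ltW lambda0)//; lra.
pose b := s == 1.
pose far K b (t : m.-tuple W) := `[< exists2 eta, 1 <= eta
  & lambda <= deviation q g K b eta t >] : bool.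
apply: (@le_trans _ _ (expect q m (fun t => (far P b t)%:R + (far N (~~ b) t)%:R))).
  apply: le_expect => // t; case Bt : (B t) => /=; last by rewrite addr_ge0.
  have [eta eta1 dev] := Bdev t Bt.
  have sum_dev : 2 * lambda <= deviation q g P b eta t
      + deviation q g N (~~ b) eta t.
    move: dev; rewrite /deviation /b /ratio; case: s_sign => ->.
      by rewrite eqxx /=; lra.
    by rewrite eq_sym -subr_eq0 opprK (_ : 1 + 1 == 0 = false) ?pnatr_eq0//=; lra.
  have [dP|dP] := leP lambda (deviation q g P b eta t).
    have -> : far P b t by apply/asboolP; exists eta.
    by rewrite lerDl.
  have -> : far N (~~ b) t by apply/asboolP; exists eta => //; lra.
  by rewrite lerDr.
have tail (K : pred I) i b' : K i -> expect q m (fun t => (far K b' t)%:R)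
    <= (2 * ln (#|K|%:R) / lambda + 1) * expR (- (lambda ^+ 2 * m%:R / 2)).
  move=> Ki; apply: (uniform_deviation_tail q g q_ge0 q_sum1 g01 m_gt0 K i Ki b')
    => // t; first exact: asboolW.
rewrite expectD; apply: le_trans (lerD (tail P ip b Pip) (tail N ineg _ Pin)) _.
rewrite -mulrDl ler_wpM2r ?expR_ge0// ler_pdivlMr// !mulrDl mul1r.
rewrite !divfK ?gt_eqF//.
have := ln_card_le P ip Pip; have := ln_card_le N ineg Pin; lra.
Qed.

End log_ratio_tail.

(** * From measures to finite sums *)

Section finite_image.
Context {d : measure_display} {T : measurableType d} {R : realType}.

Lemma measurable_forall (J : finType) (F : J -> set T) :
  (forall j, measurable (F j)) -> measurable [set x | forall j, F j x].
Proof.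
move=> mF; rewrite (_ : [set x | _] = \bigcap_(j in [set: J]) F j).
  exact: fin_bigcap_measurable.
by apply/seteqP; split=> [x Fx j _|x Fx j]; apply: Fx.
Qed.

Definition finite_law (P : probability T R) (W : finType) (f : T -> W) (w : W) : R :=
  fine (P [set x | f x = w]).

Context (P : probability T R) (W : finType) (f : T -> W).
Context (mf : forall w, measurable [set x | f x = w]).

Lemma measure_finite_preimage (A : pred W) :
  P [set x | A (f x)] = (\sum_(w | A w) finite_law P W f w)%:E.
Proof.
rewrite -sumEFin.
rewrite (_ : [set x | _] = \bigcup_(w in [set` A]) (f @^-1` [set w])); last first.
  apply/seteqP; split=> [x Ax|x [w Aw /= fxw] /=]; first by exists (f x).
  by rewrite fxw.
rewrite measure_fin_bigcup//; [|exact: trivIset_preimage1|by move=> w _; exact: mf].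
rewrite -(bigfs _ (r := index_enum W)) ?index_enum_uniq//; last first.
  by move=> w _; rewrite mem_index_enum.
by apply: eq_bigr => w _; rewrite fineK// fin_num_measure.
Qed.

Lemma finite_law_ge0 w : 0 <= finite_law P W f w.
Proof. by rewrite fine_ge0. Qed.

Lemma finite_law_sum1 : \sum_w finite_law P W f w = 1.
Proof.
apply: EFin_inj; rewrite -(measure_finite_preimage predT).
by rewrite -[RHS](probability_setT P); congr (P _); apply/seteqP; split.
Qed.

End finite_image.

(** An event that factors through a map [f] with finitely many values is a finite
    union of measurable rectangles, so an independent sample behaves as one drawn
    from the law of [f]. *)
Lemma power_probability_finite (d : measure_display) (T : measurableType d)
    (R : realType) (P : probability T R) (W : finType) (f : T -> W) (m : nat)
    (B : pred (m.-tuple W)) :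
  (forall w, measurable [set x | f x = w]) ->
  power_probability P m [set S | B (map_tuple f S)]
  = (expect (finite_law P W f) m (fun t => (B t)%:R))%:E.
Proof.
move=> mf; have fiberE t : [set S | map_tuple f S = t]
    = [set S : m.-tuple T | forall k, f (tnth S k) = tnth t k].
  apply/seteqP; split=> S /= St; first by move=> k; rewrite -St tnth_map.
  by apply: eq_from_tnth => k; rewrite tnth_map.
rewrite measure_finite_preimage => [|t]; last first.
  rewrite fiberE; apply: measurable_forall => k.
  rewrite -[X in measurable X]setTI.
  by have := @measurable_tnth _ T m k measurableT _ (mf (tnth t k)).
congr (_%:E); rewrite /expect big_mkcond; apply: eq_bigr => t _.
case: (B t); rewrite ?mulr0 ?mulr1// /finite_law fiberE.
rewrite (power_probability_rect P (A := fun k => [set z | f z = tnth t k]))//.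
under eq_bigr do rewrite -[P _]fineK ?fin_num_measure//.
by rewrite prodEFin.
Qed.

Lemma measurable_misclassified (d : measure_display) (X : measurableType d)
  (h : X -> bool) : measurable_fun [set: X] h ->
  measurable [set z : X * bool | h z.1 != z.2].
Proof.
move=> mh; pose A := (h \o fst) @^-1` [set true] : set (X * bool).
pose C := snd @^-1` [set true] : set (X * bool).
have mA : measurable A.
  rewrite -[A]setTI; apply: (measurableT_comp mh measurable_fst) => //.
have mC : measurable C by rewrite -[C]setTI; exact: measurable_snd.
rewrite (_ : [set z | _] = (A `\` C) `|` (C `\` A)).
  by apply: measurableU; exact: measurableD.
apply/seteqP; rewrite /A /C; split=> -[z b] /=; case: (h z) b => -[]//=; intuition.
Qed.

(** * Error patterns of a finite class of hypotheses *)

Section error_pattern.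
Context {d : measure_display} {X : measurableType d} {R : realType}.
Context (H : {fset X -> bool}).

Definition error_pattern (z : X * bool) : {ffun H -> bool} :=
  [ffun i => val i z.1 != z.2].

Definition zero_one_loss (i : H) (w : {ffun H -> bool}) : R := (w i)%:R.

Lemma zero_one_loss01 i w : 0 <= zero_one_loss i w <= 1.
Proof. by rewrite /zero_one_loss ler0n lern1 leq_b1. Qed.

Lemma empirical_error_pattern m (S : m.-tuple (X * bool)) (i : H) :
  empirical_error R S (val i)
  = empirical_risk zero_one_loss (map_tuple error_pattern S) i.
Proof.
rewrite /empirical_error /empirical_risk; congr (_ * _).
by apply: eq_bigr => k _; rewrite /zero_one_loss tnth_map ffunE.
Qed.

Context (mH : forall h : X -> bool, h \in H -> measurable_fun [set: X] h).

Lemma measurable_error_pattern w : measurable [set z | error_pattern z = w].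
Proof.
rewrite (_ : [set z | _] = [set z | forall i : H, (val i z.1 != z.2) = w i]).
  apply: measurable_forall => i.
  have := measurable_misclassified d X (val i) (mH _ (valP i)).
  set E := [set z | _] => mE; case: (w i).
    by rewrite [X in measurable X](_ : _ = E)//; apply/seteqP; split.
  rewrite [X in measurable X](_ : _ = ~` E); first exact: measurableC.
  by apply/seteqP; split=> z; rewrite /E/=; [move=> -> | move=> /negP/negbTE].
apply/seteqP; split=> z /= zw; first by move=> i; rewrite -zw ffunE.
by apply/ffunP => i; rewrite ffunE; exact: zw.
Qed.

Lemma true_error_pattern (D : probability (X * bool)%type R) (i : H) :
  true_error D (val i)
  = risk (finite_law D {ffun H -> bool} error_pattern) zero_one_loss i.
Proof.
rewrite /true_error (_ : [set z | _] = [set z | error_pattern z i]); last first.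
  by apply/seteqP; split=> z; rewrite /= ffunE.
rewrite (measure_finite_preimage D _ _ measurable_error_pattern (fun w => w i))/=.
rewrite /risk /mean big_mkcond/=; apply: eq_bigr => w _; rewrite /zero_one_loss.
by case: (w i); rewrite ?mulr1 ?mulr0.
Qed.

End error_pattern.

Lemma log_ratioE (d : measure_display) (X : measurableType d) (R : realType)
    (H : {fset X -> bool}) (err : (X -> bool) -> R) (eta : R) (x : X) :
  let agree (i : H) := val i x in
  (exists i, agree i) -> (exists i, ~~ agree i) ->
  log_ratio H err eta x = (log_partition agree eta (err \o val)
    - log_partition (fun i => ~~ agree i) eta (err \o val))%:E.
Proof.
move=> agree [ip Pip] [ineg Pin]; rewrite /log_ratio.
have -> : all (fun h => h x) H = false.
  by apply/negbTE/allPn; exists (val ineg) => //; exact: valP.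
have -> : all (fun h => ~~ h x) H = false.
  by apply/negbTE/allPn; exists (val ip); [exact: valP|rewrite negbK].
rewrite !big_seq_fsetE/= ln_div ?posrE -?mulrBr//.
- exact: (partition_fun_gt0 agree ip).
- exact: (partition_fun_gt0 (fun i => ~~ agree i) ineg).
Qed.

(** * The uniform bound *)

Theorem theorem5 (R : realType) (d : measure_display) (X : measurableType d)
  (H : {fset X -> bool}) (H_neq0 : H != fset0)
  (mH : forall h : X -> bool, h \in H -> measurable_fun [set: X] h)
  (m : nat) (m_ge1 : (1 <= m)%N)
  (D : probability (X * bool)%type R) (x : X)
  (lambda : R) (lambda_gt0 : 0 < lambda) (s : R) (s_sign : s = 1 \/ s = -1) :
  (power_probability D m
     [set S : m.-tuple (X * bool) | exists2 eta : R, (1 <= eta)%R &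
        (2 * lambda + eta / (8 * m%:R))%:E <=
        s%:E * diff0 (log_ratio H (true_error D) eta x)
                     (log_ratio H (empirical_error R S) eta x)]
   <= (8 * ln (#|` H|%:R) / lambda * expR (- (lambda ^+ 2 * m%:R / 2)))%:E)%E.
Proof.
set E := [set S | _]; set bound := (X in (_ <= X%:E)%E).
have event_empty : (forall (err err' : (X -> bool) -> R) eta,
    log_ratio H err eta x = log_ratio H err' eta x) ->
    (power_probability D m E <= bound%:E)%E.
  move=> same; rewrite (_ : E = set0).
    rewrite measure0 lee_fin mulr_ge0 ?expR_ge0// divr_ge0 ?(ltW lambda_gt0)//.
    by rewrite mulr_ge0// ln_ge0// ler1n cardfs_gt0.
  apply/seteqP; split=> // S [eta eta1] /=.
  rewrite (same _ (empirical_error R S)) /diff0 eqxx mule0 lee_fin leNgt.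
  rewrite addr_gt0 ?mulr_gt0 ?invr_gt0 ?mulr_gt0 ?ltr0n//.
  exact: lt_le_trans eta1.
have [allT|] := boolP (all (fun h => h x) H).
  by apply: event_empty => err err' eta; rewrite /log_ratio allT.
move=> /allPn[hneg Hneg hneg_x].
have [allF|] := boolP (all (fun h => ~~ h x) H).
  by apply: event_empty => err err' eta; rewrite /log_ratio allF; case: ifP.
move=> /allPn[hpos Hpos]; rewrite negbK => hpos_x.
pose agree (i : H) := val i x.
have ex_pos : exists i : H, agree i by exists [` Hpos]%fset.
have ex_neg : exists i : H, ~~ agree i by exists [` Hneg]%fset.
have mpattern := measurable_error_pattern H mH.
pose q := finite_law D {ffun H -> bool} (error_pattern H).
pose g := @zero_one_loss d X R H.
pose ratio (e : H -> R) (eta : R) := log_partition agree eta e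
  - log_partition (fun i => ~~ agree i) eta e.
pose B (t : m.-tuple {ffun H -> bool}) :=
  `[< exists2 eta, 1 <= eta & 2 * lambda + eta / (8 * m%:R)
    <= s * (ratio (risk q g) eta - ratio (empirical_risk g t) eta) >].
have eventE S eta : (((2 * lambda + eta / (8 * m%:R))%:E <=
    s%:E * diff0 (log_ratio H (true_error D) eta x)
                 (log_ratio H (empirical_error R S) eta x))%E : Prop) <->
    2 * lambda + eta / (8 * m%:R) <= s * (ratio (risk q g) eta
      - ratio (empirical_risk g (map_tuple (error_pattern H) S)) eta).
  rewrite !log_ratioE//.
  have -> : true_error D \o val = risk q g.
    by apply/funext => i; exact: true_error_pattern.
  have -> : empirical_error R S \o val
      = empirical_risk g (map_tuple (error_pattern H) S).
    by apply/funext => i; exact: empirical_error_pattern.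
  rewrite -/(ratio _ _) -/(ratio _ _) /diff0; case: eqVneq => [[->]|_].
    by rewrite subrr mule0 mulr0 lee_fin.
  by rewrite -EFinB -EFinM lee_fin.
rewrite (_ : E = [set S | B (map_tuple (error_pattern H) S)]).
  rewrite power_probability_finite// lee_fin /bound cardfE.
  apply: (log_ratio_deviation_tail q g _ _ _ m_ge1 agree s) => //.
  - exact: finite_law_ge0.
  - exact: finite_law_sum1.
  - exact: zero_one_loss01.
  - by move=> t; exact: asboolW.
apply/seteqP; split=> S /=.
  by move=> [eta eta1 /eventE dev]; apply/asboolP; exists eta.
by move=> /asboolP[eta eta1 /eventE dev]; exists eta.
Qed.
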